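(* Let $K \subset L$ be a central extension of division rings, let $n \ge 1$, and let $A$ be an $n$-dimensional $K$-subspace of $L$ which does not contain any (left or right) linear translate of a nontrivial finite dimensional sub-division ring of $L$. Then $A$ is matched to any $n$-dimensional $K$-subspace $B$ of $L$ provided $1 \notin B$.
   Context: A central extension of division rings $K \subset L$ means that $L$ is a division ring and $K$ is a subfield of the center of $L$. Dimensions are over $K$, and $\langle S \rangle$ denotes the $K$-subspace of $L$ generated by a subset $S$. Sub-division rings $M$ of $L$ are understood to satisfy $K \subset M \subset L$; $M$ is trivial if $M = K$ and nontrivial otherwise. A left (resp. right) linear translate of a sub-division ring $M$ is a $K$-subspace of the form $lM$ (resp. $Ml$) for a nonzero element $l \in L$. Let $A$ and $B$ be $n$-dimensional $K$-subspaces of $L$, $n \ge 1$. An ordered basis $\{a_1,\dots,a_n\}$ of $A$ is matched to an ordered basis $\{b_1,\dots,b_n\}$ of $B$ if for all $1 \le i \le n$, $$a_i^{-1}A \cap B \subset \langle b_1,\dots,\hat{b}_i,\dots,b_n\rangle,$$ where the right-hand side is the $K$-subspace generated by $\{b_1,\dots,b_n\}\setminus\{b_i\}$. The subspace $A$ is matched to the subspace $B$ if every ordered basis of $A$ can be matched to some ordered basis of $B$. *)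

(* Defs.v *)
From HB Require Import structures.
From mathcomp Require Import all_boot all_algebra.
From mathcomp Require Import boolp classical_sets.

Set Implicit Arguments.
Unset Strict Implicit.
Unset Printing Implicit Defensive.

Import GRing.Theory.
Local Open Scope ring_scope.
Local Open Scope classical_set_scope.

(* [L] is an arbitrary K-algebra, possibly of infinite dimension, so subspaces
   are sets in [set L] rather than elements of [{vspace L}]. *)
Section Subspaces.
Variables (K : fieldType) (L : lmodType K).

Definition lin_span (S : set L) : set L :=
  smallest [set V : set L | GRing.submod_closed [in V]] S.

Definition lin_indep n (a : 'I_n -> L) : Prop :=
  forall c : 'I_n -> K, \sum_(i < n) c i *: a i = 0 -> forall i, c i = 0.

Definition ordered_basis n (a : 'I_n -> L) (A : set L) : Prop :=
  lin_indep a /\ lin_span (range a) = A.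

Definition subspace_of_dim n (A : set L) : Prop :=
  GRing.submod_closed [in A] /\ exists a : 'I_n -> L, ordered_basis a A.

End Subspaces.

(* A division ring [L] with [K] a subfield of its center is a [unitAlgType K]
   (scalars [k%:A] are central) in which every nonzero element is a unit. *)
Definition division_ring (L : unitRingType) : Prop :=
  forall x : L, x != 0 -> x \is a GRing.unit.

Section Matching.
Variables (K : fieldType) (L : unitAlgType K).

(* As 0^-1 = 0, closure of M under u / v is harmless at v = 0; closure under
   linear combinations together with 1 \in M gives K \subset M. *)
Definition sub_division_ring (M : set L) : Prop := GRing.divalg_closed [in M].

Definition scalars : set L := range (fun k : K => k%:A).

Definition nontrivial_fin_dim_sub_division_ring (M : set L) : Prop :=
  [/\ sub_division_ring M, M <> scalars & exists m, subspace_of_dim m M].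

Definition left_translate (l : L) (M : set L) : set L := [set l * x | x in M].

Definition right_translate (M : set L) (l : L) : set L := [set x * l | x in M].

Definition contains_translate (A : set L) : Prop :=
  exists (M : set L) (l : L),
    [/\ nontrivial_fin_dim_sub_division_ring M, l != 0 &
        left_translate l M `<=` A \/ right_translate M l `<=` A].

Definition basis_matched (A B : set L) n (a b : 'I_n -> L) : Prop :=
  forall i : 'I_n,
    left_translate (a i)^-1 A `&` B `<=` lin_span (range b `\ b i).

Definition matched n (A B : set L) : Prop :=
  forall a : 'I_n -> L, ordered_basis a A ->
    exists b : 'I_n -> L, ordered_basis b B /\ basis_matched A B a b.

End Matching.

(* Main.v *)
From HB Require Import structures.
Require Import Defs.
From mathcomp Require Import all_boot all_algebra zify.
From mathcomp Require Import boolp classical_sets.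

(* Fix a basis a of A. A matched basis of B amounts to linearly independent
   functionals f_i on B with f_i = 0 on a_i^-1 A \cap B. By the linear form of
   Rado's theorem they exist once dim V + dim W <= n whenever V is spanned by
   some of the a_i, and W \subset B satisfies V W \subset A. As 1 \notin W, we
   may replace W by W + K, so it is enough that dim V + dim W - 1 <= dim A when
   V W \subset A; this is a Kemperman-type bound, valid because A contains no
   translate of a nontrivial sub-division ring. *)

Set Implicit Arguments.
Unset Strict Implicit.
Unset Printing Implicit Defensive.

Import GRing.Theory.
Local Open Scope ring_scope.
Local Open Scope classical_set_scope.

(** * Finite-dimensional subspaces as sets, handled through coordinates *)

Section Dimension.
Variables (K : fieldType) (L : lmodType K).
Implicit Types U V W : set L.

Lemma submodP V : GRing.submod_closed [in V] <->
  V 0 /\ forall c u v, V u -> V v -> V (c *: u + v).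
Proof.
split=> [[V0 VD]|[V0 VD]]; split.
- exact: set_mem.
- by move=> c u v Vu Vv; apply/set_mem/VD; apply/mem_set.
- exact: mem_set.
- by move=> c u v /set_mem Vu /set_mem Vv; apply/mem_set/VD.
Qed.

Lemma submod_sum V (I : finType) (c : I -> K) (f : I -> L) :
  GRing.submod_closed [in V] -> (forall i, V (f i)) ->
  V (\sum_i c i *: f i).
Proof.
move=> /submodP[V0 VD] Vf; elim/big_rec: _ => // i x _ Vx; exact: VD.
Qed.

(** Coefficients form a row vector, so that subspaces spanned in terms of [a] can be treated as row
    spaces of matrices. *)
Definition lcomb n (a : 'I_n -> L) (u : 'rV[K]_n) : L :=
  \sum_(i < n) u 0 i *: a i.

Lemma lcomb_is_linear n (a : 'I_n -> L) : linear (lcomb a).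
Proof.
move=> c u v; rewrite /lcomb scaler_sumr -big_split /=.
by apply: eq_bigr => i _; rewrite !mxE scalerDl scalerA.
Qed.

HB.instance Definition _ n (a : 'I_n -> L) :=
  GRing.isLinear.Build K 'rV[K]_n L _ (lcomb a) (lcomb_is_linear a).

Lemma lcomb_delta n (a : 'I_n -> L) i : lcomb a (delta_mx 0 i) = a i.
Proof.
rewrite /lcomb (bigD1 i) //= mxE !eqxx scale1r big1 ?addr0 // => j /negPf ji.
by rewrite mxE ji scale0r.
Qed.

Lemma lcomb_mul m n (a : 'I_n -> L) (M : 'M[K]_(m, n)) u :
  lcomb a (u *m M) = lcomb (fun i => lcomb a (row i M)) u.
Proof.
rewrite /lcomb (eq_bigr (fun j => \sum_i (u 0 i * M i j) *: a j)); last first.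
  by move=> j _; rewrite !mxE scaler_suml.
rewrite exchange_big /=; apply: eq_bigr => i _; rewrite scaler_sumr.
by apply: eq_bigr => j _; rewrite !mxE scalerA.
Qed.

Lemma lin_indepP n (a : 'I_n -> L) :
  lin_indep a <-> forall u, lcomb a u = 0 -> u = 0.
Proof.
split=> [ia u /ia u0|ia c c0 i].
  by apply/rowP => i; rewrite u0 mxE.
have /rowP/(_ i): \row_j c j = 0.
  by apply: ia; rewrite -[RHS]c0; apply: eq_bigr => j _; rewrite mxE.
by rewrite !mxE.
Qed.

Lemma lcomb_inj n (a : 'I_n -> L) : lin_indep a -> injective (lcomb a).
Proof.
move=> /lin_indepP ia u v /eqP; rewrite -subr_eq0 -raddfB => /eqP/ia/eqP.
by rewrite subr_eq0 => /eqP.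
Qed.

Lemma range_lcomb_submod n (a : 'I_n -> L) :
  GRing.submod_closed [in range (lcomb a)].
Proof.
apply/submodP; split; first by exists 0; rewrite ?raddf0.
by move=> c _ _ [u _ <-] [v _ <-]; exists (c *: u + v); rewrite ?linearP.
Qed.

Lemma lin_span_range n (a : 'I_n -> L) :
  lin_span (range a) = range (lcomb a).
Proof.
apply/seteqP; split=> [|_ [u _ <-]].
  apply: smallest_sub; first exact: range_lcomb_submod.
  by move=> _ [i _ <-]; exists (delta_mx 0 i); rewrite ?lcomb_delta.
move=> V [Vlin aV]; apply: submod_sum => // i; apply: aV; exact: imageP.
Qed.

Lemma dim_submod n V : subspace_of_dim n V -> GRing.submod_closed [in V].
Proof. by case. Qed.

Lemma dimP n V : subspace_of_dim n V <->
  exists a : 'I_n -> L, lin_indep a /\ range (lcomb a) = V.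
Proof.
split=> [[_ [a [ia Va]]]|[a [ia Va]]].
  by exists a; rewrite -lin_span_range.
split; first by rewrite -Va; exact: range_lcomb_submod.
by exists a; split=> //; rewrite lin_span_range.
Qed.

(* Steinitz exchange, read off the rank of the coordinate matrix. *)
Lemma lin_indep_lcomb_le m n (a : 'I_m -> L) (b : 'I_n -> L) :
  lin_indep a -> (forall i, range (lcomb b) (a i)) -> (m <= n)%N.
Proof.
move=> /lin_indepP ia ba.
have /choice[M bM] i : exists u, lcomb b u = a i by case: (ba i) => u; exists u.
have <- : \rank (\matrix_i M i) = m; last exact: rank_leq_col.
apply/eqP; rewrite -/(row_free _) -kermx_eq0; apply/eqP/row_matrixP => i.
rewrite row0; apply: ia.
rewrite (_ : a = (fun i => lcomb b (row i (\matrix_i M i)))); last first.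
  by apply/funext => j; rewrite rowK.
by rewrite -lcomb_mul -row_mul mulmx_ker row0 raddf0.
Qed.

Lemma lin_indep_le m n (a : 'I_m -> L) V :
  subspace_of_dim n V -> lin_indep a -> (forall i, V (a i)) -> (m <= n)%N.
Proof. by move=> /dimP[b [_ <-]]; apply: lin_indep_lcomb_le. Qed.

Lemma dim_le m n U V : subspace_of_dim m U -> subspace_of_dim n V ->
  U `<=` V -> (m <= n)%N.
Proof.
move=> /dimP[a [ia Ua]] dV UV; apply: (lin_indep_le dV ia) => i; apply: UV.
by rewrite -Ua; exists (delta_mx 0 i); rewrite ?lcomb_delta.
Qed.

Lemma dim_uniq m n U : subspace_of_dim m U -> subspace_of_dim n U -> m = n.
Proof.
by move=> dm dn; apply/eqP; rewrite eqn_leq (dim_le dm dn) ?(dim_le dn dm).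
Qed.

Definition mximage m n (a : 'I_n -> L) (M : 'M[K]_(m, n)) : set L :=
  lcomb a @` [set u | (u <= M)%MS].

Lemma dim_mximage m n (a : 'I_n -> L) (M : 'M[K]_(m, n)) :
  lin_indep a -> subspace_of_dim (\rank M) (mximage a M).
Proof.
move=> ia; apply/dimP.
exists (fun i => lcomb a (row i (row_base M))); split.
  apply/lin_indepP => u; rewrite -lcomb_mul => /(lin_indepP a).1.
  move=> /(_ ia)/eqP; rewrite mulmx_free_eq0 ?row_base_free // => /eqP //.
apply/seteqP; split=> [_ [u _ <-]|_ [u /= uM <-]].
  rewrite -lcomb_mul; exists (u *m row_base M) => //=.
  by rewrite (submx_trans (submxMl _ _)) // eq_row_base.
have /submxP[w ->] : (u <= row_base M)%MS by rewrite eq_row_base.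
by exists w => //; rewrite lcomb_mul.
Qed.

(** Converse of [dim_mximage]: the rows of [M] are the coordinates of a basis of [U], and uniqueness
    of dimension gives the rank. Together they turn statements on dimensions into statements on
    ranks. *)
Lemma dim_coord k n (a : 'I_n -> L) U : lin_indep a ->
  subspace_of_dim k U -> U `<=` range (lcomb a) ->
  exists M : 'M[K]_(k, n), \rank M = k /\ U = mximage a M.
Proof.
move=> ia dU; have /dimP[b [ib Ub]] := dU => Ua.
have /choice[M bM] i : exists u, lcomb a u = b i.
  have [|u _ <-] := Ua (b i); last by exists u.
  by rewrite -Ub; exists (delta_mx 0 i); rewrite ?lcomb_delta.
have UM : U = mximage a (\matrix_i M i).
  have bE : b = (fun i => lcomb a (row i (\matrix_i M i))).
    by apply/funext => j; rewrite rowK.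
  rewrite -Ub bE; apply/seteqP; split=> [_ [u _ <-]|_ [_ /submxP[u ->] <-]].
    by rewrite -lcomb_mul; exists (u *m \matrix_i M i) => //=; apply: submxMl.
  by rewrite lcomb_mul; exists u.
exists (\matrix_i M i); split=> //.
by apply: (@dim_uniq _ _ U) => //; rewrite {1}UM; apply: dim_mximage.
Qed.

Lemma lin_indep_rcons n (a : 'I_n -> L) x : lin_indep a ->
  ~ range (lcomb a) x ->
  lin_indep (fun i : 'I_n.+1 => oapp a x (unlift ord_max i)).
Proof.
move=> ia nx c; rewrite (bigD1_ord ord_max) //= unlift_none /=.
under eq_bigr do rewrite liftK /=.
move=> c0; have cx0: c ord_max = 0.
  apply: contra_notP nx => /eqP cn0.
  exists (\row_i (- (c ord_max)^-1 * c (lift ord_max i))) => //.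
  rewrite /lcomb; under eq_bigr do rewrite mxE -scalerA.
  rewrite -scaler_sumr scaleNr -scalerN; move/eqP: c0; rewrite addr_eq0 => /eqP.
  by move/(congr1 -%R); rewrite opprK => <-; rewrite opprK scalerK.
move: c0; rewrite cx0 scale0r add0r => /ia ci i.
by case: (unliftP ord_max i) => [j ->|->].
Qed.

(** A longest independent family in [U] spans [U], since a vector outside its span could be
    appended; the bound [N] makes a longest one exist. *)
Lemma dim_ex N U : GRing.submod_closed [in U] ->
  (forall m (a : 'I_m -> L),
    lin_indep a -> (forall i, U (a i)) -> (m <= N)%N) ->
  exists n, subspace_of_dim n U.
Proof.
move=> Ulin bnd.
pose P m := `[< exists a : 'I_m -> L, lin_indep a /\ forall i, U (a i) >].
have P0 : exists m, P m.
  by exists 0%N; apply/asboolP; exists (fun=> 0); split=> [c _|] [].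
have Pb m : P m -> (m <= N)%N by move=> /asboolP[a [ia aU]]; exact: bnd ia aU.
case: (ex_maxnP P0 Pb) => n /asboolP[a [ia aU]] maxn.
exists n; apply/dimP; exists a; split=> //.
apply/seteqP; split=> [_ [u _ <-]|x Ux]; first exact: submod_sum.
apply: contrapT => nx; suff /maxn : P n.+1 by rewrite ltnn.
apply/asboolP; exists (fun i => oapp a x (unlift ord_max i)).
split=> [|i]; first exact: lin_indep_rcons.
by case: (unlift ord_max i) => [j|] /=.
Qed.

Lemma dim_sub n U V : subspace_of_dim n V -> GRing.submod_closed [in U] ->
  U `<=` V -> exists2 m, (m <= n)%N & subspace_of_dim m U.
Proof.
move=> dV Ulin UV.
have [|m dU] := @dim_ex n U Ulin.
  by move=> m a ia aU; apply: (lin_indep_le dV ia) => i; apply: UV.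
by exists m => //; apply: dim_le dU dV UV.
Qed.

Lemma dim_eq n U V : subspace_of_dim n U -> subspace_of_dim n V ->
  U `<=` V -> U = V.
Proof.
move=> dU /dimP[b [ib <-]] UV.
have [M [rM ->]] := dim_coord ib dU UV.
apply/seteqP; split=> [x [u _ <-]|x [u _ <-]]; exists u => //=.
by rewrite submx_full // /row_full rM.
Qed.

Definition addsp U V : set L := [set x + y | x in U & y in V].

Lemma addsp_submod U V : GRing.submod_closed [in U] ->
  GRing.submod_closed [in V] -> GRing.submod_closed [in addsp U V].
Proof.
move=> /submodP[U0 UD] /submodP[V0 VD]; apply/submodP; split.
  by exists 0 => //; exists 0; rewrite ?addr0.
move=> c _ _ [x Ux [y Vy <-]] [x' Ux' [y' Vy' <-]].
exists (c *: x + x'); first exact: UD.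
exists (c *: y + y'); first exact: VD.
by rewrite scalerDr addrACA.
Qed.

Lemma subl_addsp U V : V 0 -> U `<=` addsp U V.
Proof. by move=> V0 x Ux; exists x => //; exists 0; rewrite ?addr0. Qed.

Lemma subr_addsp U V : U 0 -> V `<=` addsp U V.
Proof. by move=> U0 x Vx; exists 0 => //; exists x; rewrite ?add0r. Qed.

Lemma dim_addsp m n U V : subspace_of_dim m U -> subspace_of_dim n V ->
  exists k, subspace_of_dim k (addsp U V).
Proof.
move=> dU dV; apply: (@dim_ex (m + n)).
  by apply: addsp_submod; apply: dim_submod; eassumption.
move: dU dV => /dimP[a [ia <-]] /dimP[b [ib <-]] k c ic cUV.
pose f (i : 'I_(m + n)) := match split i with inl j => a j | inr j => b j end.
apply: (@lin_indep_lcomb_le _ _ c f) => // i.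
have [_ [u _ <-] [_ [v _ <-] <-]] := cUV i.
exists (row_mx u v) => //; rewrite [LHS]/lcomb big_split_ord /=; congr (_ + _).
  by apply: eq_bigr => j _; rewrite row_mxEl /f -/(unsplit (inl j)) unsplitK.
by apply: eq_bigr => j _; rewrite row_mxEr /f -/(unsplit (inr j)) unsplitK.
Qed.

(** In coordinates over a basis of U + V, this is the rank formula for the sum and intersection of
    row spaces. *)
Lemma dim_add_cap m n U V : subspace_of_dim m U -> subspace_of_dim n V ->
  exists s t, [/\ subspace_of_dim s (addsp U V), subspace_of_dim t (U `&` V)
    & (s + t = m + n)%N].
Proof.
move=> dU dV; have [k /dimP[f [fi fUV]]] := dim_addsp dU dV.
have /submodP[U0 _] := dim_submod dU; have /submodP[V0 _] := dim_submod dV.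
have [|A [rA UA]] := dim_coord fi dU.
  by rewrite fUV; apply: subl_addsp.
have [|B [rB VB]] := dim_coord fi dV.
  by rewrite fUV; apply: subr_addsp.
exists (\rank (A + B)%MS), (\rank (A :&: B)%MS); split.
- suff -> : addsp U V = mximage f (A + B)%MS by apply: dim_mximage.
  rewrite UA VB; apply/seteqP; split.
    move=> _ [_ [u uA <-] [_ [v vB <-] <-]].
    exists (u + v); rewrite ?raddfD //=.
    by rewrite addmx_sub_adds.
  move=> _ [_ /sub_addsmxP[[u v] /= ->] <-]; rewrite raddfD /=.
  exists (lcomb f (u *m A)); first by exists (u *m A) => //=; apply: submxMl.
  by exists (lcomb f (v *m B)) => //; exists (v *m B) => //=; apply: submxMl.
- suff -> : U `&` V = mximage f (A :&: B)%MS by apply: dim_mximage.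
  rewrite UA VB; apply/seteqP; split.
    move=> _ [[u uA <-] [v vB] /(lcomb_inj fi) uv].
    by exists u => //=; rewrite sub_capmx uA -uv.
  move=> _ [u /= + <-]; rewrite sub_capmx => /andP[uA uB].
  by split; exists u.
- by rewrite mxrank_sum_cap rA rB.
Qed.

Lemma dim_gt0P n U : subspace_of_dim n U ->
  (0 < n)%N <-> exists2 x, U x & x != 0.
Proof.
move=> dU; split.
  case: n dU => // n /dimP[a [/lin_indepP ia <-]] _; exists (a ord0).
    by exists (delta_mx 0 ord0); rewrite ?lcomb_delta.
  apply/eqP => a0; have := ia (delta_mx 0 ord0); rewrite lcomb_delta.
  by move=> /(_ a0)/rowP/(_ ord0)/eqP; rewrite !mxE !eqxx oner_eq0.
case: n dU => // /dimP[a [_ <-]] [_ [u _ <-]].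
by rewrite /lcomb big_ord0 eqxx.
Qed.

Lemma dim_line (x : L) : x != 0 ->
  subspace_of_dim 1 [set k *: x | k in setT].
Proof.
move=> x0; apply/dimP; exists (fun=> x); split.
  move=> c; rewrite big_ord1 => /eqP; rewrite scaler_eq0 (negPf x0) orbF.
  by move=> /eqP c0 i; rewrite ord1.
apply/seteqP; split=> [_ [u _ <-]|_ [k _ <-]].
  by exists (u 0 0) => //; rewrite /lcomb big_ord1.
by exists (const_mx k) => //; rewrite /lcomb big_ord1 mxE.
Qed.

End Dimension.

Lemma dim_image (K : fieldType) (L L' : lmodType K) (g : {linear L -> L'}) n U :
  (forall x, g x = 0 -> x = 0) ->
  subspace_of_dim n U -> subspace_of_dim n (g @` U).
Proof.
move=> g0 /dimP[a [/lin_indepP ia <-]]; apply/dimP.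
have gE u : lcomb (g \o a) u = g (lcomb a u).
  by rewrite raddf_sum; apply: eq_bigr => i _; rewrite -linearZZ.
exists (g \o a); split.
  by apply/lin_indepP => u; rewrite gE => /g0/ia.
apply/seteqP; split=> [_ [u _ <-]|_ [_ [u _ <-] <-]]; rewrite ?gE.
  by exists (lcomb a u) => //; exists u.
by exists u.
Qed.

(** * Rado's theorem for families of subspaces *)

(* When some F i has rank at least 2, write it as a sum of two proper
   subspaces; by submodularity of the rank, replacing F i by one of the two
   preserves the hypothesis. *)
Lemma rado (K : fieldType) (I : finType) n (F : I -> 'M[K]_n) :
  (forall J : {set I}, #|J| <= \rank (\sum_(i in J) F i)%MS)%N ->
  exists v : I -> 'rV[K]_n, (forall i, v i <= F i)%MS /\
    (#|I| <= \rank (\sum_i <<v i>>)%MS)%N.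
Proof.
have [m] := ubnP (\sum_i \rank (F i))%N; elim: m => // m IH in F *.
rewrite ltnS => Fm hall.
have [/forallP F1|/forallPn[i0]] := boolP [forall i, \rank (F i) <= 1]%N.
  (* Each [F i] of rank at most 1 is spanned by its [nz_row], so the hypothesis for the full index
     set is the conclusion. *)
  exists (fun i => nz_row (F i)); split=> [i|]; first exact: nz_row_sub.
  have := hall (setTfor I); rewrite cardsT => /leq_trans; apply.
  apply/mxrankS/sumsmx_subP => i _; apply: (sumsmx_sup i) => //.
  rewrite -(geq_leqif (mxrank_leqif_sup _)) ?genmxE ?nz_row_sub //.
  rewrite rank_rV nz_row_eq0 -mxrank_eq0.
  by have := F1 i; case: (\rank _) => [|[]].
rewrite -ltnNge => F2.
have Fn0 : F i0 != 0 by rewrite -mxrank_eq0 -lt0n; apply: leq_trans F2.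
(* [H] is a line in [F i0] and [H'] a complement of it there; both have smaller rank than [F i0]. *)
set H := <<nz_row (F i0)>>%MS; set H' := (F i0 :\: H)%MS.
have HF : (H <= F i0)%MS by rewrite genmxE nz_row_sub.
have H'F : (H' <= F i0)%MS by rewrite diffmxSl.
have FHH' : (F i0 <= H + H')%MS.
  rewrite -(addsmx_diff_cap_eq (F i0) H) addsmxC addsmxS //.
  exact: capmxSr.
have rH : \rank H = 1%N by rewrite genmxE rank_rV nz_row_eq0 Fn0.
have rH' : (\rank H' < \rank (F i0))%N.
  by rewrite -(mxrank_cap_compl (F i0) H) (capmx_idPr HF) rH.
pose G X i := if i == i0 then X else F i.
have GF X : (X <= F i0)%MS -> forall i, (G X i <= F i)%MS.
  by move=> XF i; rewrite /G; case: eqP => // ->.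
suff [X [XF rX hX]] : exists X : 'M_n,
    [/\ (X <= F i0)%MS, (\rank X < \rank (F i0))%N &
    forall J : {set I}, (#|J| <= \rank (\sum_(i in J) G X i)%MS)%N].
  have [|v [vG vr]] := IH (G X) _ hX; last first.
    by exists v; split=> // i; apply: submx_trans (GF _ XF i).
  apply: leq_trans Fm; rewrite (bigD1 i0) //= [X in (_ < X)%N](bigD1 i0) //=.
  rewrite -addSn {1}/G eqxx leq_add //.
  apply: eq_leq; apply: eq_bigr => i /negPf ii0.
  by rewrite /G ii0.
have [/forallP hH|/forallPn[J]] :=
  boolP [forall J : {set I}, (#|J| <= \rank (\sum_(i in J) G H i)%MS)%N].
  by exists H; split=> //; rewrite rH.
rewrite -ltnNge => hJ.
have [/forallP hH'|/forallPn[J']] :=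
  boolP [forall J : {set I}, (#|J| <= \rank (\sum_(i in J) G H' i)%MS)%N].
  by exists H'.
rewrite -ltnNge => hJ'; exfalso.
(* A set violating the condition for [G X] contains [i0], as [G X] and [F] agree elsewhere. *)
have inJ X (J1 : {set I}) :
    (\rank (\sum_(i in J1) G X i)%MS < #|J1|)%N -> i0 \in J1.
  apply: contraTT => i0J; rewrite -leqNgt (leq_trans (hall J1)) // mxrankS //.
  apply/sumsmx_subP => i iJ; apply: (sumsmx_sup i) => //; rewrite /G.
  by case: eqP iJ i0J => // -> ->.
have i0J := inJ _ _ hJ; have i0J' := inJ _ _ hJ'.
set S := (\sum_(i in J) _)%MS in hJ; set S' := (\sum_(i in J') _)%MS in hJ'.
have sup : (#|J :|: J'| <= \rank (S + S')%MS)%N.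
  apply: leq_trans (hall _) _; apply/mxrankS/sumsmx_subP => i.
  have [-> _|ii0] := eqVneq i i0.
    apply: submx_trans FHH' _; apply: addsmxS; apply: (sumsmx_sup i0) => //;
    by rewrite /G eqxx.
  rewrite inE => /orP[] iJ.
    apply: submx_trans (addsmxSl _ _); apply: (sumsmx_sup i) => //.
    by rewrite /G (negPf ii0).
  apply: submx_trans (addsmxSr _ _); apply: (sumsmx_sup i) => //.
  by rewrite /G (negPf ii0).
have inf : (#|J :&: J' :\ i0| <= \rank (S :&: S')%MS)%N.
  apply: leq_trans (hall _) _; apply/mxrankS/sumsmx_subP => i.
  rewrite !inE => /and3P[ii0 iJ iJ']; rewrite sub_capmx.
  by apply/andP; split; apply: (sumsmx_sup i) => //; rewrite /G (negPf ii0).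
(* Only [i0] is lost in [inf], so |J| + |J'| - 1 is at most rank S + rank S', which two strict
   violations bound by |J| + |J'| - 2. *)
have := leq_add sup inf; rewrite mxrank_sum_cap.
have := cardsUI J J'.
rewrite (cardsD1 i0 (J :&: J')) inE i0J i0J' /= addnCA => cE.
have := leq_add hJ hJ'; rewrite -cE addSn addnS add1n ltnS => /leq_trans h /h.
by rewrite ltnn.
Qed.

(** * Elementary facts on independent families *)

Lemma lin_indep_inj (K : fieldType) (L : lmodType K) m n (a : 'I_n -> L)
    (f : 'I_m -> 'I_n) :
  injective f -> lin_indep a -> lin_indep (a \o f).
Proof.
move=> fi ia c c0 i.
have: \sum_j (\sum_(i | f i == j) c i) *: a j = 0.
  rewrite -[RHS]c0 (partition_big f predT) //=; apply: eq_bigr => j _.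
  by rewrite scaler_suml; apply: eq_bigr => k /eqP ->.
by move/ia/(_ (f i)); rewrite (big_pred1 i) // => k; rewrite /= (inj_eq fi).
Qed.

Lemma lin_indep_neq0 (K : fieldType) (L : lmodType K) n (a : 'I_n -> L) i :
  lin_indep a -> a i != 0.
Proof.
move=> /lin_indepP ia; apply/eqP => a0; have := ia (delta_mx 0 i).
rewrite lcomb_delta => /(_ a0)/rowP/(_ i)/eqP.
by rewrite !mxE !eqxx oner_eq0.
Qed.

Lemma lin_indep_injective (K : fieldType) (L : lmodType K) n (a : 'I_n -> L) :
  lin_indep a -> injective a.
Proof.
move=> ia i j; rewrite -!(lcomb_delta a) => /(lcomb_inj ia)/rowP/(_ i)/eqP.
by rewrite !mxE !eqxx /=; case: (i =P j) => [->//|_]; rewrite oner_eq0.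
Qed.

(** * Translates and products of subspaces in a division ring *)

Section Translates.
Variables (K : fieldType) (L : unitAlgType K).
Hypothesis divL : division_ring L.
Implicit Types (x y : L) (U V W : set L).

(** Multiplications are named to carry a linear structure, so that [dim_image] applies to
    translates. *)
Let lmul x y := x * y.
Let lmul_linear x : linear (lmul x).
Proof. by move=> c u v; rewrite /lmul mulrDr scalerAr. Qed.
HB.instance Definition _ x :=
  GRing.isLinear.Build K L L _ (lmul x) (lmul_linear x).

Let rmul x y := y * x.
Let rmul_linear x : linear (rmul x).
Proof. by move=> c u v; rewrite /rmul mulrDl scalerAl. Qed.
HB.instance Definition _ x :=
  GRing.isLinear.Build K L L _ (rmul x) (rmul_linear x).

Lemma divring_mul_neq0 x y : x != 0 -> y != 0 -> x * y != 0.
Proof.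
move=> x0; apply: contra_neq => xy0.
by rewrite -(mulKr (divL x0) y) xy0 mulr0.
Qed.

Lemma dim_left_translate n x U : x != 0 -> subspace_of_dim n U ->
  subspace_of_dim n (left_translate x U).
Proof.
move=> x0; apply: (@dim_image _ _ _ (lmul x)) => y /(congr1 (lmul x^-1)).
by rewrite /lmul mulr0 mulKr ?divL.
Qed.

Lemma dim_right_translate n x U : x != 0 -> subspace_of_dim n U ->
  subspace_of_dim n (right_translate U x).
Proof.
move=> x0; apply: (@dim_image _ _ _ (rmul x)) => y /(congr1 (rmul x^-1)).
by rewrite /rmul mul0r mulrK ?divL.
Qed.

(* The right multipliers of [U] form a sub-division ring: it is closed under
   inverses because [U * z] and [U] have the same dimension. *)
Lemma right_multiplier_scalar A U p y :
  ~ contains_translate A -> U `<=` A -> subspace_of_dim p U -> (0 < p)%N ->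
  (forall u, U u -> U (u * y)) -> exists k : K, y = k%:A.
Proof.
move=> noA UA dU p0 Uy.
have /submodP[U0 UD] := dim_submod dU.
have /(dim_gt0P dU)[l Ul l0] := p0.
pose M := [set z | forall u, U u -> U (u * z)].
have Mlin : GRing.submod_closed [in M].
  apply/submodP; split=> [u Uu|c z w Mz Mw u Uu]; first by rewrite mulr0.
  by rewrite mulrDr -scalerAr; apply: UD; [apply: Mz|apply: Mw].
have lM : left_translate l M `<=` U by move=> _ [z Mz <-]; apply: Mz.
have MV z : M z -> M z^-1.
  have [->|z0] := eqVneq z 0; first by rewrite invr0.
  move=> Mz u Uu; have /seteqP[_ /(_ u Uu) [v Vv <-]] : right_translate U z = U.
    apply: dim_eq (dim_right_translate z0 dU) dU _.
    by move=> _ [v Uv <-]; apply: Mz.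
  by rewrite mulrK ?divL.
(* The translate l M lies in [U], hence is finite dimensional; multiplying by the inverse of [l]
   carries this over to [M]. *)
have [m dM] : exists m, subspace_of_dim m M.
  have lMlin : GRing.submod_closed [in left_translate l M].
    have /submodP[M0 MD] := Mlin; apply/submodP; split.
      by exists 0; rewrite ?mulr0.
    move=> c _ _ [z Mz <-] [w Mw <-]; exists (c *: z + w); first exact: MD.
    by rewrite mulrDr scalerAr.
  have [m _ dlM] := dim_sub dU lMlin lM.
  have lV0 : l^-1 != 0 by rewrite invr_eq0.
  exists m; have := dim_left_translate lV0 dlM; congr subspace_of_dim.
  apply/seteqP; split=> [_ [_ [z Mz <-] <-]|z Mz]; rewrite ?mulKr ?divL //.
  by exists (l * z); [exists z|rewrite mulKr ?divL].
apply: contrapT => yK; apply: noA; exists M, l; split=> //; last first.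
  by left=> z /lM/UA.
split; last by exists m.
- split; first by apply/mem_set => u; rewrite mulr1.
    by case: Mlin.
  move=> z w /set_mem Mz /set_mem Mw; apply/mem_set => u Uu.
  by rewrite mulrA; apply: MV => //; apply: Mz.
- move=> MK; apply: yK; have : M y by [].
  by rewrite MK => -[k _ <-]; exists k.
Qed.

(* Among the pairs with product in [A], the dimension sum is pushed up by the
   transforms (V + Vx, W \cap x^-1 W) and (V \cap V x^-1, W + x W), one of
   which never decreases it. When neither helps, [Vx = V] and [x] is a scalar;
   hence a W \cap V b is the line of [a b] and a W + V b is large. *)
Lemma dim_product_le A n : subspace_of_dim n A -> ~ contains_translate A ->
  forall V W p q, subspace_of_dim p V -> subspace_of_dim q W ->
  (0 < p)%N -> (0 < q)%N -> (forall v w, V v -> W w -> A (v * w)) ->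
  (p + q <= n.+1)%N.
Proof.
move=> dA noA V W p q.
have /submodP[A0 AD] := dim_submod dA.
have AA u v : A u -> A v -> A (u + v).
  by move=> Au /(AD 1 _ _ Au); rewrite scale1r.
have bound V' W' p' q' : subspace_of_dim p' V' -> subspace_of_dim q' W' ->
  (0 < p')%N -> (0 < q')%N -> (forall v w, V' v -> W' w -> A (v * w)) ->
  (p' <= n)%N /\ (q' <= n)%N.
  move=> dV dW /(dim_gt0P dV)[a Va a0] /(dim_gt0P dW)[b Wb b0] VWA; split.
    apply: dim_le (dim_right_translate b0 dV) dA _.
    by move=> _ [v Vv <-]; exact: VWA.
  apply: dim_le (dim_left_translate a0 dW) dA _.
  by move=> _ [v Vv <-]; exact: VWA.
(* The measure encodes the lexicographic order on (p + q, p), to be increased: n - p is below the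
   weight [n.+1]. *)
have [m] := ubnP ((n + n - (p + q)) * n.+1 + (n - p))%N.
elim: m => // m IH in V W p q *; rewrite ltnS => mes dV dW p0 q0 VWA.
have [pn qn] := bound _ _ _ _ dV dW p0 q0 VWA.
have IHgt V' W' p' q' : subspace_of_dim p' V' -> subspace_of_dim q' W' ->
  (0 < p')%N -> (0 < q')%N -> (forall v w, V' v -> W' w -> A (v * w)) ->
  (p + q < p' + q')%N || ((p + q == p' + q')%N && (p < p')%N) ->
  (p + q <= n.+1)%N.
  move=> dV' dW' p'0 q'0 VWA' pq.
  have [p'n q'n] := bound _ _ _ _ dV' dW' p'0 q'0 VWA'.
  have: (p' + q' <= n.+1)%N.
    apply: (IH V' W') => //; apply: leq_trans mes.
    case/orP: pq => [lt|/andP[/eqP <- lt]]; last by lia.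
    have : ((n + n - (p' + q')).+1 * n.+1 <= (n + n - (p + q)) * n.+1)%N.
      by rewrite leq_mul2r; lia.
    by rewrite mulSn; lia.
  lia.
have /(dim_gt0P dV)[a Va a0] := p0; have /(dim_gt0P dW)[b Wb b0] := q0.
have ab0 := divring_mul_neq0 a0 b0.
have [s [t [ds dt st]]] :=
  dim_add_cap (dim_left_translate a0 dW) (dim_right_translate b0 dV).
have sn : (s <= n)%N.
  apply: dim_le ds dA _ => _ [_ [w Ww <-] [_ [v Vv <-] <-]].
  by apply: AA; apply: VWA.
(* Here s + t = p + q and s <= n, so only an intersection larger than a line needs work. *)
have [t1|t1] := leqP t 1; first by lia.
have [z [[w Ww aw] [v Vv vb]] nz] : exists2 z,
    (left_translate a W `&` right_translate V b) z &
    ~ [set k *: (a * b) | k in setT] z.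
  apply: contrapT => nz; have := dim_le dt (dim_line ab0); rewrite leqNgt t1.
  move=> /(_ _)/negP; case=> // z zab; apply: contrapT => zab'.
  by apply: nz; exists z.
have v0 : v != 0.
  apply: contra_notN nz => /eqP v0; exists 0 => //.
  by rewrite -vb v0 mul0r scale0r.
(* With z = a w = v b one gets a x = v and x b = w. So [v] lies in V \cap V x and [w] in W \cap x W,
   which keeps both transforms nonzero; a scalar [x] would put [z] on the line of a b. *)
pose x := a^-1 * v.
have x0 : x != 0 by rewrite divring_mul_neq0 ?invr_eq0.
have ax : a * x = v by rewrite mulVKr ?divL.
have xb : x * b = w by rewrite -mulrA vb -aw mulKr ?divL.
have xK : ~ exists k : K, x = k%:A.
  case=> k xk; apply: nz; exists k => //.
  by rewrite -vb -ax xk -scalerAr mulr1 scalerAl.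
have [s1 [t1' [ds1 dt1 st1]]] := dim_add_cap dV (dim_right_translate x0 dV).
have [s2 [t2 [ds2 dt2 st2]]] := dim_add_cap dW (dim_left_translate x0 dW).
have xV0 : x^-1 != 0 by rewrite invr_eq0.
have t1'0 : (0 < t1')%N.
  by apply/(dim_gt0P dt1); exists v => //; split=> //; exists a.
have t20 : (0 < t2)%N.
  apply/(dim_gt0P dt2); exists w; last by rewrite -xb divring_mul_neq0.
  by split=> //; exists b.
have /submodP[V0 _] := dim_submod dV.
have Vx0 : right_translate V x 0 by exists 0; rewrite ?mul0r.
have ps1 : (p <= s1)%N by apply: dim_le dV ds1 _; exact: subl_addsp.
have IH1 := IHgt _ _ _ _ ds1 (dim_left_translate xV0 dt2).
have IH2 := IHgt _ _ _ _ (dim_right_translate xV0 dt1) ds2.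
have P1 v' w' : addsp V (right_translate V x) v' ->
    left_translate x^-1 (W `&` left_translate x W) w' -> A (v' * w').
  move=> [v1 Vv1 [_ [v2 Vv2 <-] <-]] [y [Wy [w1 Ww1 yE]] <-].
  rewrite -yE in Wy *; rewrite mulKr ?divL // mulrDl -mulrA.
  by apply: AA; apply: VWA.
have P2 v' w' : right_translate (V `&` right_translate V x) x^-1 v' ->
    addsp W (left_translate x W) w' -> A (v' * w').
  move=> [y [Vy [v1 Vv1 yE]] <-] [w1 Ww1 [_ [w2 Ww2 <-] <-]].
  rewrite -yE in Vy *; rewrite mulrK ?divL // mulrDr mulrA.
  by apply: AA; apply: VWA.
(* Since s1 + t1' = 2p and s2 + t2 = 2q, the two transformed pairs have dimension sums adding up to
   2(p + q): if neither sum exceeds p + q, both equal it. *)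
have [gt|le] := ltnP (p + q) (s1 + t2).
  by apply: IH1 => //; [lia|rewrite gt].
have [gt|le2] := ltnP (p + q) (t1' + s2).
  by apply: IH2 => //; [lia|rewrite gt].
have [eq|lt] := leqP s1 p; last first.
  apply: IH1 => //; first by lia.
  by apply/orP; right; rewrite lt andbT; apply/eqP; lia.
have {eq ps1} eq : s1 = p by lia.
rewrite {}eq in ds1; have VE := dim_eq dV ds1 (subl_addsp Vx0).
(* [V] need not lie in [A], but V b does; so the multiplier [x] of [V] is conjugated by [b] into a
   multiplier of V b. *)
exfalso; have bxb u : right_translate V b u ->
    right_translate V b (u * (b^-1 * x * b)).
  move=> [u' Vu' <-]; exists (u' * x); last by rewrite !mulrA mulrK ?divL.
  by rewrite VE; apply: subr_addsp => //; exists u'.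
have dVb := dim_right_translate b0 dV.
have [|k xk] := right_multiplier_scalar noA _ dVb p0 bxb.
  by move=> _ [u Vu <-]; apply: VWA.
apply: xK; exists k; have := congr1 (fun y => b * y / b) xk.
rewrite -scalerAr mulr1 -scalerAl divrr ?divL // !mulrA.
by rewrite mulrV ?divL // mul1r mulrK ?divL.
Qed.

(** This will be the rank condition of [rado]. All elements of [A] that multiply [W] into [A] form a
    subspace [V] containing the chosen a_j, and [V] multiplies W + K into [A] as well. The extra
    dimension of W + K offsets the [n.+1] of [dim_product_le]. *)
Lemma card_add_dim_le A n (a : 'I_n -> L) (J : {set 'I_n}) W d :
  ordered_basis a A -> ~ contains_translate A -> (0 < #|J|)%N ->
  subspace_of_dim d W -> ~ W 1 ->
  (forall j w, j \in J -> W w -> A (a j * w)) -> (#|J| + d <= n)%N.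
Proof.
move=> [ia aA] noA J0 dW W1 JWA.
have dA : subspace_of_dim n A.
  by apply/dimP; exists a; split=> //; rewrite -lin_span_range.
have /submodP[A0 AD] := dim_submod dA.
have /submodP[W0 WD] := dim_submod dW.
pose V := [set v | A v /\ forall w, W w -> A (v * w)].
have [p _ dV] : exists2 p, (p <= n)%N & subspace_of_dim p V.
  apply: (dim_sub dA); last by move=> v [].
  apply/submodP; split; first by split=> // w _; rewrite mul0r.
  move=> c u v [Au Vu] [Av Vv]; split; first exact: AD.
  by move=> w Ww; rewrite mulrDl -scalerAl; apply: AD; [apply: Vu|apply: Vv].
have Jp : (#|J| <= p)%N.
  apply: (lin_indep_le dV (lin_indep_inj (@enum_val_inj _ (mem J)) ia)) => i.
  split; last by move=> w; apply: JWA; apply: enum_valP.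
  by rewrite -aA; move=> Z [_]; apply; exists (enum_val i).
have [s [t [ds dt st]]] := dim_add_cap dW (dim_line (oner_neq0 L)).
(* The line K meets [W] trivially because 1 is not in [W], so W + K has dimension d + 1. *)
have t0 : t = 0%N.
  apply/eqP; rewrite -leqn0 leqNgt; apply/negP.
  move=> /(dim_gt0P dt)[x [Wx [k _ kx]] x0].
  move: Wx x0; rewrite -kx => Wk k0; apply: W1.
  move: Wk => /(WD k^-1 _ 0)/(_ W0); rewrite addr0 scalerK //.
  by apply: contra_neq k0 => ->; rewrite scale0r.
rewrite t0 addn0 addn1 in st; rewrite st in ds.
suff: (p + d.+1 <= n.+1)%N.
  by rewrite addnS ltnS; apply: leq_trans; rewrite leq_add2r.
apply: (dim_product_le dA noA dV ds) => //; first exact: leq_trans Jp.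
move=> v _ [Av Vv] [w Ww [_ [k _ <-] <-]].
rewrite mulrDr -scalerAr mulr1 addrC; apply: AD => //; exact: Vv.
Qed.

End Translates.

(** * Construction of the matched basis *)

Theorem theorem3p3 (K : fieldType) (L : unitAlgType K) (n : nat) (A : set L)
    (divL : division_ring L) (n_ge1 : (1 <= n)%N)
    (dimA : subspace_of_dim n A) (noA : ~ contains_translate A) :
  forall B : set L, subspace_of_dim n B -> ~ B 1 -> matched n A B.
Proof.
move=> B dB B1 a aA; have [ia _] := aA.
have /submodP[A0 AD] := dim_submod dimA.
have /submodP[B0 BD] := dim_submod dB.
have /dimP[e [ie eB]] := dB.
(* The row space of [M i] is the intersection of a_i^-1 A with [B], in coordinates over the basis
   [e] of [B]. *)
have /choice[M MA] i : exists M : 'M[K]_n,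
    forall u, (u <= M)%MS <-> A (a i * lcomb e u).
  have [|x [Bx _]|d _ dW] := @dim_sub _ _ n [set x | B x /\ A (a i * x)] _ dB.
  - apply/submodP; split; first by split=> //; rewrite mulr0.
    move=> c x y [Bx Ax] [By Ay]; split; first exact: BD.
    by rewrite mulrDr -scalerAr; apply: AD.
  - by [].
  have [x [Bx _]|M [_ WM]] := dim_coord ie dW; first by rewrite eB.
  exists <<M>>%MS => u; rewrite genmxE; split=> [uM|Au].
    suff : mximage e M (lcomb e u) by rewrite -WM => -[].
    by exists u.
  suff : mximage e M (lcomb e u) by case=> w wM /(lcomb_inj ie) <-.
  by rewrite -WM; split=> //; rewrite -eB; exists u.
(* The rows of the transposed cokernel span the functionals that vanish on [M i]. For a set [J], the
   common zeros of those with index in [J] form a subspace of dimension n - rank S that every a_j, j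
   in [J], multiplies into [A]. *)
have [J|v [vF vr]] := @rado K 'I_n n (fun i => (cokermx (M i))^T).
  have [->//|J0] := posnP #|J|.
  set S := (\sum_(i in J) _)%MS.
  have := card_add_dim_le divL aA noA J0 (dim_mximage (kermx S^T) ie).
  rewrite mxrank_ker mxrank_tr => le.
  rewrite -(leq_add2r (n - \rank S)) subnKC ?rank_leq_row //; apply: le.
    by move=> [u _ u1]; apply: B1; rewrite -eB; exists u.
  move=> j _ jJ [u /= /sub_kermxP uS <-]; apply/MA; rewrite submxE.
  have /submxP[X FX] : ((cokermx (M j))^T <= S)%MS by apply: (sumsmx_sup j).
  by rewrite -[cokermx _]trmxK FX trmx_mul mulmxA uS mul0mx.
pose C := \matrix_i v i; have Cu : C^T \in unitmx.
  rewrite unitmx_tr -row_full_unit /row_full eqn_leq rank_leq_col.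
  rewrite card_ord in vr; apply: leq_trans vr _.
  apply/mxrankS/sumsmx_subP => i _.
  by rewrite genmxE -(rowK v i) row_sub.
(* The basis dual to the functionals [v i]: the coordinates over [b] of the vector with
   [e]-coordinates [u] are the values of the [v i] at [u]. *)
pose b i := lcomb e (row i (invmx C^T)).
have bE u : lcomb e u = lcomb b (u *m C^T).
  by rewrite -lcomb_mul mulmxK.
have ib : lin_indep b.
  apply/lin_indepP => u; rewrite -lcomb_mul => /((lin_indepP e).1 ie)/eqP.
  by rewrite mulmx_free_eq0 ?row_free_unit ?unitmx_inv // => /eqP.
exists b; split.
  split=> //; rewrite lin_span_range -eB; apply/seteqP; split=> _ [u _ <-].
    by rewrite -lcomb_mul; exists (u *m invmx C^T).
  by rewrite bE; exists (u *m C^T).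
move=> i x [[y Ay xy] Bx]; move: Bx; rewrite -eB => -[u _ ux].
have ai : a i \is a GRing.unit by apply/divL/lin_indep_neq0.
have uM : (u <= M i)%MS by apply/MA; rewrite ux -xy mulVKr.
(* The coordinate along [b i] is the value of [v i], which vanishes on [M i]. *)
have ci : (u *m C^T) 0 i = 0.
  have /submxP[X vX] := vF i; have : u *m (v i)^T = 0.
    rewrite vX trmx_mul trmxK mulmxA; move: uM; rewrite submxE => /eqP ->.
    by rewrite mul0mx.
  move/matrixP/(_ 0 0); rewrite !mxE => uv; rewrite -[RHS]uv.
  by apply: eq_bigr => k _; rewrite !mxE.
rewrite -ux bE => Z [Zlin bZ]; have /submodP[Z0 _] := Zlin.
rewrite /lcomb.
(* As its coefficient is 0, [b i] may be replaced by 0; the other vectors stay in the range without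
   [b i] because [b] is injective. *)
rewrite (eq_bigr (fun j => (u *m C^T) 0 j *: (if j == i then 0 else b j))).
  apply: submod_sum => // j; case: eqP => // ji.
  apply: bZ; split; first by exists j.
  by move=> /(lin_indep_injective ib).
by move=> j _; case: eqP => // ->; rewrite ci !scale0r.
Qed.
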